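(* Let $A$ and $B$ be commutative rings with unity, $f: A\to B$ a ring homomorphism, and $J$ an ideal of $B$. Let $A\Join^f J := \{(a, f(a)+j) \mid a\in A,\ j\in J\}$ (a subring of $A\times B$). Assume that $J$ is a regular ideal of $B$ and that $f^{-1}(J)$ is a regular ideal of $A$. Then the integral closure $\overline{A\Join^f J}$ of $A\Join^f J$ in its total ring of fractions coincides with $\overline{A}\times\overline{f(A)+J}$. In particular, if $f$ is an integral homomorphism, then $\overline{A\Join^f J}=\overline{A}\times\overline{B}$.
   Context: An ideal is regular if it contains a regular element (a non-zero-divisor) of the ring. For a ring $R$, $\operatorname{Tot}(R)$ is its total ring of fractions and $\overline{R}$ denotes the integral closure of $R$ in $\operatorname{Tot}(R)$. Here $f(A)+J$ is a subring of $B$. Under the regularity hypotheses, $\operatorname{Tot}(A\Join^f J)$ is canonically identified (via the inclusion $A\Join^f J\subseteq A\times B$) with $\operatorname{Tot}(A)\times\operatorname{Tot}(B)$, and $\operatorname{Tot}(f(A)+J)$ with $\operatorname{Tot}(B)$; the equalities are understood inside $\operatorname{Tot}(A)\times\operatorname{Tot}(B)$. The homomorphism $f$ is integral if $B$ is integral over $f(A)$. *)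

(* Defs.v *)
From HB Require Import structures.
From mathcomp Require Import all_boot all_algebra.
From mathcomp Require Import boolp classical_sets.
From mathcomp Require Import ring.

Set Implicit Arguments.
Unset Strict Implicit.
Unset Printing Implicit Defensive.

Import GRing.Theory.
Local Open Scope ring_scope.
Local Open Scope quotient_scope.
Local Open Scope classical_set_scope.

(* Rings are [comPzRingType]s, i.e. the zero ring is allowed.  In a commutative
   ring the regular elements (non-zero-divisors) are the [GRing.lreg] ones, see
   [lregP]. *)

Lemma lregP (R : comPzRingType) (x : R) :
  GRing.lreg x <-> (forall y, x * y = 0 -> y = 0).
Proof.
split=> [xreg y xy0|xreg y z /eqP]; first by apply: xreg; rewrite mulr0.
by rewrite -subr_eq0 -mulrBr => /eqP/xreg/eqP; rewrite subr_eq0 => /eqP.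
Qed.

(* Unlike MathComp's [idealr], the unit ideal is allowed. *)
Record ideal (R : comPzRingType) := Ideal {
  ideal_set :> set R;
  ideal0 : ideal_set 0;
  idealD : forall x y, ideal_set x -> ideal_set y -> ideal_set (x + y);
  idealM : forall r x, ideal_set x -> ideal_set (r * x)
}.

Definition regular_ideal (R : comPzRingType) (I : ideal R) : Prop :=
  exists2 x, ideal_set I x & GRing.lreg x.

Section PreimIdeal.
Variables (A B : comPzRingType) (f : {rmorphism A -> B}) (J : ideal B).

Let P : set A := f @^-1` J.

Let P0 : P 0. Proof. by rewrite /P /= rmorph0; exact: ideal0. Qed.

Let PD x y : P x -> P y -> P (x + y).
Proof. by rewrite /P /= rmorphD; exact: idealD. Qed.

Let PM r x : P x -> P (r * x).
Proof. by rewrite /P /= rmorphM; exact: idealM. Qed.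

Definition preim_ideal : ideal A := Ideal P0 PD PM.

End PreimIdeal.

(* The total ring of fractions: pairs (n, d) with d regular, modulo
   (n, d) ~ (n', d') iff n * d' = d * n'.  The construction follows that of
   [{fraction R}] in mathcomp.algebra.fraction, which is limited to integral
   domains. *)
Section Tot.
Variable R : comPzRingType.

Inductive tratio := TRatio { tfrac :> R * R; _ : `[< GRing.lreg tfrac.2 >] }.

HB.instance Definition _ := [isSub for tfrac].
HB.instance Definition _ := [Choice of tratio by <:].

Lemma tdenomP (x : tratio) : GRing.lreg x.2.
Proof. by case: x => x /= /asboolP. Qed.

Definition mk_tratio (n d : R) (dreg : GRing.lreg d) : tratio :=
  @TRatio (n, d) (asboolT dreg).

Definition tequiv : rel tratio := fun x y => x.1 * y.2 == x.2 * y.1.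

Lemma tequiv_refl : reflexive tequiv.
Proof. by move=> x; rewrite /tequiv mulrC. Qed.

Lemma tequiv_sym : symmetric tequiv.
Proof. by move=> x y; rewrite /tequiv eq_sym; congr (_ == _); rewrite mulrC. Qed.

Lemma tequiv_trans : transitive tequiv.
Proof.
move=> y x z /eqP xy /eqP yz; apply/eqP/(@tdenomP y).
by rewrite mulrA [y.2 * x.1]mulrC xy -mulrA yz mulrCA.
Qed.

Canonical tequiv_equiv := EquivRel tequiv tequiv_refl tequiv_sym tequiv_trans.

Definition tot := {eq_quot tequiv}.

HB.instance Definition _ : EqQuotient _ tequiv tot := EqQuotient.on tot.
HB.instance Definition _ := Choice.on tot.

Lemma tequiv_repr (x : tratio) :
  x.1 * (repr (\pi_tot x)).2 = x.2 * (repr (\pi_tot x)).1.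
Proof.
by apply/eqP; rewrite -/(tequiv x _); apply/eqmodP; rewrite reprK.
Qed.

Definition tratio_of (x : R) : tratio := mk_tratio x (@GRing.lreg1 R).

Definition to_tot : R -> tot := lift_embed tot tratio_of.
Canonical to_tot_pi_morph := PiEmbed to_tot.

Definition taddr (x y : tratio) : tratio :=
  mk_tratio (x.1 * y.2 + y.1 * x.2) (GRing.lregM (@tdenomP x) (@tdenomP y)).
Definition tot_add := lift_op2 tot taddr.

Lemma pi_tot_add : {morph \pi : x y / taddr x y >-> tot_add x y}.
Proof.
move=> x y; unlock tot_add; apply/eqmodP/eqP => /=.
have hx := tequiv_repr x; have hy := tequiv_repr y.
set x' := repr _ in hx *; set y' := repr _ in hy *.
transitivity ((x.1 * x'.2) * (y.2 * y'.2) + (y.1 * y'.2) * (x.2 * x'.2)).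
  by ring.
by rewrite hx hy; ring.
Qed.
Canonical pi_tot_add_morph := PiMorph2 pi_tot_add.

Definition toppr (x : tratio) : tratio := mk_tratio (- x.1) (@tdenomP x).
Definition tot_opp := lift_op1 tot toppr.

Lemma pi_tot_opp : {morph \pi : x / toppr x >-> tot_opp x}.
Proof.
move=> x; unlock tot_opp; apply/eqmodP/eqP => /=.
by rewrite mulNr mulrN tequiv_repr.
Qed.
Canonical pi_tot_opp_morph := PiMorph1 pi_tot_opp.

Definition tmulr (x y : tratio) : tratio :=
  mk_tratio (x.1 * y.1) (GRing.lregM (@tdenomP x) (@tdenomP y)).
Definition tot_mul := lift_op2 tot tmulr.

Lemma pi_tot_mul : {morph \pi : x y / tmulr x y >-> tot_mul x y}.
Proof.
move=> x y; unlock tot_mul; apply/eqmodP/eqP => /=.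
by rewrite mulrACA !tequiv_repr mulrACA.
Qed.
Canonical pi_tot_mul_morph := PiMorph2 pi_tot_mul.

Lemma tot_addA : associative tot_add.
Proof.
elim/quotW=> x; elim/quotW=> y; elim/quotW=> z; rewrite !piE.
by apply/eqmodP/eqP => /=; ring.
Qed.

Lemma tot_addC : commutative tot_add.
Proof.
elim/quotW=> x; elim/quotW=> y; rewrite !piE.
by apply/eqmodP/eqP => /=; ring.
Qed.

Lemma tot_add0 : left_id (to_tot 0) tot_add.
Proof.
by elim/quotW=> x; rewrite !piE; apply/eqmodP/eqP => /=; ring.
Qed.

Lemma tot_addN : left_inverse (to_tot 0) tot_opp tot_add.
Proof.
by elim/quotW=> x; rewrite !piE; apply/eqmodP/eqP => /=; ring.
Qed.

HB.instance Definition _ :=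
  GRing.isZmodule.Build tot tot_addA tot_addC tot_add0 tot_addN.

Lemma tot_mulA : associative tot_mul.
Proof.
elim/quotW=> x; elim/quotW=> y; elim/quotW=> z; rewrite !piE.
by apply/eqmodP/eqP => /=; ring.
Qed.

Lemma tot_mulC : commutative tot_mul.
Proof.
elim/quotW=> x; elim/quotW=> y; rewrite !piE.
by apply/eqmodP/eqP => /=; ring.
Qed.

Lemma tot_mul1 : left_id (to_tot 1) tot_mul.
Proof.
by elim/quotW=> x; rewrite !piE; apply/eqmodP/eqP => /=; ring.
Qed.

Lemma tot_mulDl : left_distributive tot_mul tot_add.
Proof.
elim/quotW=> x; elim/quotW=> y; elim/quotW=> z; rewrite !piE.
by apply/eqmodP/eqP => /=; ring.
Qed.

HB.instance Definition _ :=
  GRing.Zmodule_isComPzRing.Build tot tot_mulA tot_mulC tot_mul1 tot_mulDl.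

Lemma to_tot_is_zmod_morphism : zmod_morphism to_tot.
Proof.
move=> x y; rewrite -[RHS]/(tot_add (to_tot x) (tot_opp (to_tot y))) !piE.
by apply/eqmodP/eqP => /=; ring.
Qed.

HB.instance Definition _ :=
  GRing.isZmodMorphism.Build R tot to_tot to_tot_is_zmod_morphism.

Lemma to_tot_is_monoid_morphism : monoid_morphism to_tot.
Proof.
split=> [//|x y]; rewrite -[RHS]/(tot_mul (to_tot x) (to_tot y)) !piE.
by apply/eqmodP/eqP => /=; ring.
Qed.

HB.instance Definition _ :=
  GRing.isMonoidMorphism.Build R tot to_tot to_tot_is_monoid_morphism.

Lemma to_tot_inj : injective to_tot.
Proof.
move=> x y; rewrite /to_tot; unlock; move=> /eqmodP/eqP /=.
by rewrite mulr1 mul1r.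
Qed.

Lemma to_tot_unit (d : R) : GRing.lreg d -> exists u, u * to_tot d = 1.
Proof.
move=> dreg; exists (\pi_tot (mk_tratio 1 dreg)).
rewrite -[RHS]/(to_tot 1) -[LHS]/(tot_mul _ _) !piE.
by apply/eqmodP/eqP => /=; ring.
Qed.

Lemma tot_fracP (u : tot) :
  exists n d : R, GRing.lreg d /\ u * to_tot d = to_tot n.
Proof.
elim/quotW: u => x; exists x.1, x.2; split; first exact: tdenomP.
rewrite -[LHS]/(tot_mul _ _) !piE.
by apply/eqmodP/eqP => /=; ring.
Qed.

Lemma tot_rmorph_inj (S : comPzRingType) (g h : {rmorphism tot -> S}) :
  g \o to_tot =1 h \o to_tot -> g =1 h.
Proof.
move=> gh u; have [n [d [/to_tot_unit[v vd1] ud]]] := tot_fracP u.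
have {vd1} : h v * h (to_tot d) = 1 by rewrite -rmorphM vd1 rmorph1.
have : g u * h (to_tot d) = h u * h (to_tot d).
  have gd : g (to_tot d) = h (to_tot d) := gh d.
  by rewrite -{1}gd -!rmorphM ud; exact: gh.
by move=> e; rewrite mulrC => dv; rewrite -[LHS]mulr1 -dv mulrA e -mulrA dv mulr1.
Qed.

End Tot.

(* Integrality over the image of a ring morphism.  MathComp's [integralOver]
   requires nonzero rings, where the two notions agree ([integralP]). *)
Definition integral_over (R S : comPzRingType) (g : R -> S) (u : S) : Prop :=
  exists (n : nat) (c : nat -> R),
    u ^+ n + \sum_(i < n) g (c i) * u ^+ i = 0.

Definition integral_morphism (R S : comPzRingType) (g : R -> S) : Prop :=
  forall u, integral_over g u.

Lemma integralP (R S : comNzRingType) (g : {rmorphism R -> S}) (u : S) :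
  integral_over g u <-> integralOver g u.
Proof.
split=> [[n [c eq0]]|[p pmon /rootP pu0]].
  have szc : (size (\poly_(i < n) c i) < size ('X^n : {poly R}))%N.
    by rewrite size_polyXn ltnS size_poly.
  exists ('X^n + \poly_(i < n) c i).
    by rewrite monicE lead_coefDl // lead_coefXn.
  apply/rootP; rewrite rmorphD /= map_polyXn hornerD hornerXn.
  rewrite (@horner_coef_wide _ n); last first.
    by rewrite (leq_trans (size_poly _ _)) // size_poly.
  rewrite -[RHS]eq0; congr (_ + _); apply: eq_bigr => i _.
  by rewrite coef_map coef_poly ltn_ord.
have p_gt0 : (0 < size p)%N by rewrite size_poly_gt0 monic_neq0.
exists (size p).-1, (fun i => p`_i).
rewrite -[RHS]pu0 (@horner_coef_wide _ (size p)) ?size_poly //.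
rewrite -[in RHS](prednK p_gt0) big_ord_recr /= addrC; congr (_ + _); last first.
  by apply: eq_bigr => i _; rewrite coef_map.
have/monicP := pmon; rewrite /lead_coef coef_map /= => ->.
by rewrite rmorph1 mul1r.
Qed.

Definition int_closure (R : comPzRingType) : set (tot R) :=
  [set u | integral_over (@to_tot R) u].
Arguments int_closure R : clear implicits.

Section Amalgamation.
Variables (A B : comPzRingType) (f : {rmorphism A -> B}) (J : ideal B).

Definition amalg_pred : {pred A * B} :=
  fun x => `[< exists a j, ideal_set J j /\ x = (a, f a + j) >].

Definition im_plus_pred : {pred B} :=
  fun b => `[< exists a j, ideal_set J j /\ b = f a + j >].

Let idealN x : ideal_set J x -> ideal_set J (- x).
Proof. by rewrite -mulN1r; exact: idealM. Qed.

Lemma amalg_subring : subring_closed amalg_pred.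
Proof.
split.
- apply/asboolP; exists 1, 0; split; first exact: ideal0.
  by rewrite rmorph1 addr0.
- move=> _ _ /asboolP[a [j [Jj ->]]] /asboolP[b [k [Jk ->]]].
  apply/asboolP; exists (a - b), (j - k); split.
    by apply: idealD => //; exact: idealN.
  by rewrite rmorphB; congr pair => /=; ring.
- move=> _ _ /asboolP[a [j [Jj ->]]] /asboolP[b [k [Jk ->]]].
  apply/asboolP; exists (a * b), ((f a + j) * k + f b * j); split.
    by apply: idealD; exact: idealM.
  by rewrite rmorphM; congr pair => /=; ring.
Qed.

Lemma im_plus_subring : subring_closed im_plus_pred.
Proof.
split.
- apply/asboolP; exists 1, 0; split; first exact: ideal0.
  by rewrite rmorph1 addr0.
- move=> _ _ /asboolP[a [j [Jj ->]]] /asboolP[b [k [Jk ->]]].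
  apply/asboolP; exists (a - b), (j - k); split.
    by apply: idealD => //; exact: idealN.
  by rewrite rmorphB; ring.
- move=> _ _ /asboolP[a [j [Jj ->]]] /asboolP[b [k [Jk ->]]].
  apply/asboolP; exists (a * b), ((f a + j) * k + f b * j); split.
    by apply: idealD; exact: idealM.
  by rewrite rmorphM; ring.
Qed.

Record amalg := Amalg { amalg_val :> A * B; _ : amalg_val \in amalg_pred }.
HB.instance Definition _ := [isSub for amalg_val].
HB.instance Definition _ := [Choice of amalg by <:].
HB.instance Definition _ :=
  GRing.SubChoice_isSubComPzRing.Build (A * B)%type amalg_pred amalg
    amalg_subring.

Record im_plus := ImPlus { im_plus_val :> B; _ : im_plus_val \in im_plus_pred }.
HB.instance Definition _ := [isSub for im_plus_val].
HB.instance Definition _ := [Choice of im_plus by <:].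
HB.instance Definition _ :=
  GRing.SubChoice_isSubComPzRing.Build B im_plus_pred im_plus im_plus_subring.

(* Ring isomorphisms Tot(A ⋈ J) -> Tot(A) * Tot(B) and Tot(f(A)+J) -> Tot(B)
   extending the inclusions A ⋈ J ⊆ A * B and f(A)+J ⊆ B.  There is at
   most one of each by [tot_rmorph_inj]. *)
Definition tot_amalg_iso (phi : {rmorphism tot amalg -> tot A * tot B}) : Prop :=
  bijective phi /\
  forall x : amalg,
    phi (to_tot x) = (to_tot (amalg_val x).1, to_tot (amalg_val x).2).

Definition tot_im_plus_iso (psi : {rmorphism tot im_plus -> tot B}) : Prop :=
  bijective psi /\ forall x : im_plus, psi (to_tot x) = to_tot (im_plus_val x).

End Amalgamation.

(* Main.v *)
(* If j in J and i in f^-1(J) are regular, multiplication by (i, j) sends A * B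
   into the amalgamation, and multiplication by j sends B into f(A) + J.  Hence
   regular elements of these subrings stay regular in A * B and B, and every
   fraction over A * B or B has a numerator and denominator in the subring,
   which gives the two isomorphisms.  An element (u, v) is integral over the
   amalgamation iff each coordinate is integral over the corresponding
   projection, and these projections are A and f(A) + J.  If B is integral over
   f(A), transitivity replaces f(A) + J by B. *)

Require Import Defs.
From HB Require Import structures.
From mathcomp Require Import all_boot all_algebra.
From mathcomp Require Import boolp classical_sets.
From mathcomp Require Import ring.

Set Implicit Arguments.
Unset Strict Implicit.
Unset Printing Implicit Defensive.

Import GRing.Theory.
Local Open Scope ring_scope.
Local Open Scope classical_set_scope.

(** * Extending ring morphisms to a total ring of fractions *)

Lemma tot_lift (R S : comPzRingType) (g : {rmorphism R -> S}) :
  (forall d, GRing.lreg d -> exists v, v * g d = 1) ->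
  exists phi : {rmorphism tot R -> S}, forall x, phi (to_tot x) = g x.
Proof.
move=> gunit.
have gcancel d s t : GRing.lreg d -> s * g d = t * g d -> s = t.
  move=> /gunit[v vd] e.
  by rewrite -[s]mulr1 -[t]mulr1 -vd [v * _]mulrC !mulrA e.
(* The value at u is specified by all fractions n / d representing u at once, so that sums and
   products can later be evaluated on whichever denominator is convenient. *)
have /choice[phi phiP] (u : tot R) : exists s, forall n d,
    GRing.lreg d -> u * to_tot d = to_tot n -> s * g d = g n.
  have [n0 [d0 [d0reg ud0]]] := tot_fracP u; have [v vd0] := gunit _ d0reg.
  exists (v * g n0) => n d dreg ud.
  (* Two fractions representing u agree after cross-multiplication in R, so their images under [g]
     agree too. *)
  have {ud ud0} : n0 * d = n * d0.
    by apply: to_tot_inj; rewrite !rmorphM /= -ud0 -ud; ring.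
  move=> /(congr1 g); rewrite !rmorphM -mulrA => ->.
  by rewrite mulrCA vd0 mulr1.
have phi_tot x : phi (to_tot x) = g x.
  have := phiP (to_tot x) x 1 (@GRing.lreg1 R).
  by rewrite !rmorph1 !mulr1; apply.
have phiB : zmod_morphism phi.
  move=> u v; have [n [d [dreg ud]]] := tot_fracP u.
  have [m [e [ereg ve]]] := tot_fracP v.
  have dereg := GRing.lregM dreg ereg.
  apply: (gcancel _ _ _ dereg); rewrite (phiP _ (n * e - m * d) _ dereg).
    rewrite rmorphB !rmorphM -(phiP u n d) // -(phiP v m e) //; ring.
  by rewrite rmorphB !rmorphM /= -ud -ve; ring.
have phiM : monoid_morphism phi.
  split=> [|u v]; first by rewrite -[1]/(to_tot 1) phi_tot rmorph1.
  have [n [d [dreg ud]]] := tot_fracP u.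
  have [m [e [ereg ve]]] := tot_fracP v.
  have dereg := GRing.lregM dreg ereg.
  apply: (gcancel _ _ _ dereg); rewrite (phiP _ (n * m) _ dereg).
    by rewrite !rmorphM -(phiP u n d) // -(phiP v m e) //; ring.
  by rewrite !rmorphM /= -ud -ve; ring.
pose phi' : {rmorphism tot R -> S} :=
  HB.pack phi (GRing.isZmodMorphism.Build _ _ phi phiB)
    (GRing.isMonoidMorphism.Build _ _ phi phiM).
by exists phi'.
Qed.

(** A fraction sent to 0 has its numerator killed by [g], so injectivity of [g] passes to the
    extension. The last hypothesis writes each s as a quotient of images, which gives
    surjectivity. *)
Lemma tot_iso (R S : comPzRingType) (g : {rmorphism R -> S}) :
  injective g ->
  (forall d, GRing.lreg d -> exists v, v * g d = 1) ->
  (forall s, exists n d, GRing.lreg d /\ s * g d = g n) ->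
  exists phi : {rmorphism tot R -> S},
    bijective phi /\ forall x, phi (to_tot x) = g x.
Proof.
move=> ginj gunit gfrac; have [phi phiE] := @tot_lift _ _ g gunit.
exists phi; split=> //.
have phi_inj : injective phi.
  apply: raddf_inj => u phiu0.
  have [n [d [/to_tot_unit[v vd] ud]]] := tot_fracP u.
  have n0 : n = 0.
    by apply: ginj; rewrite -phiE -ud rmorphM phiu0 mul0r rmorph0.
  by rewrite -[u]mulr1 -vd mulrCA ud n0 rmorph0 mulr0.
have /choice[psi phiK] (s : S) : exists u, phi u = s.
  have [n [d [dreg sd]]] := gfrac s; have [v vd] := to_tot_unit dreg.
  exists (v * to_tot n).
  by rewrite rmorphM !phiE -sd mulrCA -phiE -rmorphM vd rmorph1 mulr1.
by exists psi => // u; apply: phi_inj; rewrite phiK.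
Qed.

(** * Products of monic equations *)

Section MonicValues.
Variables (R S : comPzRingType) (g : {rmorphism R -> S}) (u : S).

(** This is the R-submodule of S spanned by the powers of [u] below n; [u] is integral exactly when
    some power [u ^+ n] lies in the corresponding submodule. *)
Definition low_degree_value (n : nat) (x : S) : Prop :=
  exists c : nat -> R, x = \sum_(i < n) g (c i) * u ^+ i.

Lemma low_degree_valueD n x y :
  low_degree_value n x -> low_degree_value n y -> low_degree_value n (x + y).
Proof.
move=> [c ->] [d ->]; exists (fun i => c i + d i).
by rewrite -big_split /=; apply: eq_bigr => i _; rewrite rmorphD mulrDl.
Qed.

Lemma low_degree_valueW m n x :
  (m <= n)%N -> low_degree_value m x -> low_degree_value n x.
Proof.
move=> le_mn [c ->]; exists (fun i => if (i < m)%N then c i else 0).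
rewrite (big_ord_widen n (fun i => g (c i) * u ^+ i) le_mn) big_mkcond /=.
by apply: eq_bigr => i _; case: ifP; rewrite ?rmorph0 ?mul0r.
Qed.

Lemma low_degree_valueMX m n x :
  low_degree_value n x -> low_degree_value (m + n) (u ^+ m * x).
Proof.
move=> [c ->]; exists (fun i => if (i < m)%N then 0 else c (i - m)%N).
rewrite big_split_ord /= [X in _ = X + _]big1 ?add0r => [|i _]; last first.
  by rewrite ltn_ord rmorph0 mul0r.
rewrite mulr_sumr; apply: eq_bigr => i _.
by rewrite ltnNge leq_addr /= addKn exprD mulrCA.
Qed.

Lemma low_degree_valueZ n a x :
  low_degree_value n x -> low_degree_value n (g a * x).
Proof.
move=> [c ->]; exists (fun i => a * c i).
by rewrite mulr_sumr; apply: eq_bigr => i _; rewrite rmorphM mulrA.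
Qed.

Lemma low_degree_valueM m n x y :
  low_degree_value m x -> low_degree_value n y ->
  low_degree_value (m + n) (x * y).
Proof.
move=> [c ->] yn; rewrite mulr_suml.
elim/big_ind: _ => [||i _].
- by exists (fun=> 0); rewrite big1 // => i _; rewrite rmorph0 mul0r.
- exact: low_degree_valueD.
rewrite -mulrA; apply/low_degree_valueZ.
(* Multiplication by [u ^+ i] raises the bound n to i + n, which stays below m + n because i < m. *)
apply: (@low_degree_valueW (i + n)); last exact: low_degree_valueMX.
by rewrite leq_add2r ltnW.
Qed.

(** Expanding the product leaves [u ^+ (m + n)] as leading term, and the other three terms are
    combinations of lower powers of [u]. *)
Lemma integral_over_prod0 m n (c d : nat -> R) :
  (u ^+ m + \sum_(i < m) g (c i) * u ^+ i) *
    (u ^+ n + \sum_(i < n) g (d i) * u ^+ i) = 0 ->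
  integral_over g u.
Proof.
set x := \sum_(_ < m) _; set y := \sum_(_ < n) _ => xy0.
have xm : low_degree_value m x by exists c.
have yn : low_degree_value n y by exists d.
have [e eE] : low_degree_value (m + n) (x * y + u ^+ m * y + u ^+ n * x).
  apply: low_degree_valueD; last by rewrite addnC; exact: low_degree_valueMX.
  by apply: low_degree_valueD; [exact: low_degree_valueM|exact: low_degree_valueMX].
by exists (m + n)%N, e; rewrite -eE -[RHS]xy0 exprD; ring.
Qed.

End MonicValues.

(** * Transitivity of integrality *)

Lemma integral_over_nz_trans (R S T : comNzRingType) (g : {rmorphism R -> S})
    (h : {rmorphism S -> T}) (t : T) :
  integral_morphism g -> integral_over h t -> integral_over (h \o g) t.
Proof.
move=> gint /integralP[p pmon pt0]; apply/integralP.
have pmon' : map_poly h p \is monic by rewrite monic_map.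
(* A root of a monic polynomial with integral coefficients is integral. Here the coefficients are
   the [h p_i], and a monic equation of [p_i] over R is carried along by [h]. *)
apply: (@integral_root_monic _ _ (h \o g) _ _ pmon' pt0) => _ /(nthP 0)[i _ <-].
rewrite coef_map; have /integralP[q qmon qs0] := gint p`_i.
exists q => //; rewrite map_poly_comp /=.
by move/rootP: qs0 => qs0; apply/rootP; rewrite horner_map /= qs0 rmorph0.
Qed.

Lemma integral_over_trans (R S T : comPzRingType) (g : {rmorphism R -> S})
    (h : {rmorphism S -> T}) (t : T) :
  integral_morphism g -> integral_over h t -> integral_over (h \o g) t.
Proof.
move=> gint hint; have [T0|T1] := eqVneq (1 : T) 0.
  (* In the zero ring the equation of degree 0 reads 1 = 0 and holds. *)
  by exists 0%N, (fun=> 0); rewrite -[LHS]mulr1 T0 mulr0.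
(* Since [g] and [h] preserve 1, a nonzero T forces S and R to be nonzero. *)
have S1 : (1 : S) != 0.
  by apply: contraNneq T1 => S0; rewrite -(rmorph1 h) S0 rmorph0.
have R1 : (1 : R) != 0.
  by apply: contraNneq S1 => R0; rewrite -(rmorph1 g) R0 rmorph0.
(* MathComp's integrality theory needs nonzero rings. *)
pose R' : comNzRingType := HB.pack (GRing.ComPzRing.sort R)
  (GRing.PzSemiRing_isNonZero.Build R R1).
pose S' : comNzRingType := HB.pack (GRing.ComPzRing.sort S)
  (GRing.PzSemiRing_isNonZero.Build S S1).
pose T' : comNzRingType := HB.pack (GRing.ComPzRing.sort T)
  (GRing.PzSemiRing_isNonZero.Build T T1).
exact: (@integral_over_nz_trans R' S' T' g h).
Qed.

(** * Transport of integrality between rings *)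

(** The isomorphism and its inverse carry monic equations back and forth, so a closure taken in
    [tot R] can be studied inside S. *)
Lemma tot_iso_int_closure (R S : comPzRingType) (g : R -> S)
    (phi : {rmorphism tot R -> S}) :
  bijective phi -> (forall x, phi (to_tot x) = g x) ->
  phi @` int_closure R = integral_over g.
Proof.
move=> [psi phiK psiK] phiE.
have phi_monic n (c : nat -> R) u :
    phi (u ^+ n + \sum_(i < n) to_tot (c i) * u ^+ i) =
    phi u ^+ n + \sum_(i < n) g (c i) * phi u ^+ i.
  rewrite rmorphD rmorphXn rmorph_sum /=; congr (_ + _).
  by apply: eq_bigr => i _; rewrite rmorphM rmorphXn /= phiE.
apply/seteqP; split=> [_ [u [n [c u0]] <-]|s [n [c s0]]].
  by exists n, c; rewrite -phi_monic u0 rmorph0.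
exists (psi s) => //; exists n, c; apply: (can_inj phiK).
by rewrite phi_monic psiK s0 rmorph0.
Qed.

(** Only the values of the coefficients enter a monic equation, so any choice of preimages under
    [g'] yields an equation over R'. *)
Lemma integral_over_range (R R' S : comPzRingType) (g : R -> S) (g' : R' -> S)
    (u : S) :
  (forall x, exists y, g' y = g x) -> integral_over g u -> integral_over g' u.
Proof.
move=> /choice[h hE] [n [c u0]]; exists n, (h \o c).
by apply: etrans u0; congr (_ + _); apply: eq_bigr => i _ /=; rewrite hE.
Qed.

Lemma integral_over_rmorph (R S T : comPzRingType) (g : R -> S)
    (h : {rmorphism S -> T}) (u : S) :
  integral_over g u -> integral_over (h \o g) (h u).
Proof.
move=> [n [c u0]]; exists n, c; have := congr1 h u0.
rewrite rmorph0 rmorphD rmorphXn rmorph_sum; apply: etrans; congr (_ + _).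
by apply: eq_bigr => i _; rewrite rmorphM rmorphXn.
Qed.

(* If p kills u and q kills v, then p * q kills (u, v): no lifting to a single
   polynomial killing both is needed. *)
Lemma integral_over_pair (R S T : comPzRingType) (g : {rmorphism R -> S * T})
    (u : S) (v : T) :
  integral_over g (u, v) <->
  integral_over (fst \o g) u /\ integral_over (snd \o g) v.
Proof.
split=> [uv_int|[[m [c u0]] [n [d v0]]]].
  by split; [apply: (@integral_over_rmorph _ _ _ g fst _ uv_int)
            |apply: (@integral_over_rmorph _ _ _ g snd _ uv_int)].
have monicE (k : nat) (e : nat -> R) (w := (u, v)) :
    w ^+ k + \sum_(i < k) g (e i) * w ^+ i =
    (u ^+ k + \sum_(i < k) (g (e i)).1 * u ^+ i,
     v ^+ k + \sum_(i < k) (g (e i)).2 * v ^+ i).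
  rewrite [LHS]surjective_pairing (rmorphD fst) (rmorphD snd) /=.
  rewrite (rmorphXn fst) (rmorphXn snd) (rmorph_sum fst) (rmorph_sum snd) /=.
  congr (_ + _, _ + _); apply: eq_bigr => i _ /=.
    by rewrite (rmorphXn fst).
  by rewrite (rmorphXn snd).
apply: (@integral_over_prod0 _ _ g (u, v) m n c d).
rewrite !monicE [X in (X, _) * _]u0 [X in _ * (_, X)]v0.
by apply: injective_projections; rewrite /= ?mul0r ?mulr0.
Qed.

(** * The amalgamation, f(A) + J and their total rings of fractions *)

Section Amalgamation.
Variables (A B : comPzRingType) (f : {rmorphism A -> B}) (J : ideal B).

Lemma amalg_elt a b : ideal_set J (b - f a) ->
  exists x : amalg f J, amalg_val x = (a, b).
Proof.
move=> Jba; suff ab_in : (a, b) \in amalg_pred f J by exists (Amalg ab_in).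
by apply/asboolP; exists a, (b - f a); rewrite subrKC.
Qed.

Lemma im_plus_elt a b : ideal_set J (b - f a) ->
  exists x : im_plus f J, im_plus_val x = b.
Proof.
move=> Jba; suff b_in : b \in im_plus_pred f J by exists (ImPlus b_in).
by apply/asboolP; exists a, (b - f a); rewrite subrKC.
Qed.

(** With [amalg_im_plus], this identifies the image of the second projection with f(A) + J, so that
    the two base rings can be exchanged by [integral_over_range]. *)
Lemma im_plus_amalg (y : im_plus f J) :
  exists x : amalg f J, (amalg_val x).2 = im_plus_val y.
Proof.
case: y => b /= /asboolP[a [j [Jj ->]]].
have [|x xE] := @amalg_elt a (f a + j); first by rewrite addrC addKr.
by exists x; rewrite xE.
Qed.

Lemma amalg_im_plus (x : amalg f J) :
  exists y : im_plus f J, im_plus_val y = (amalg_val x).2.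
Proof.
case: x => _ /= /asboolP[a [j [Jj ->]]].
by apply: (@im_plus_elt a); rewrite addrC addKr.
Qed.

Definition amalg_tot (x : amalg f J) : tot A * tot B :=
  (to_tot (amalg_val x).1, to_tot (amalg_val x).2).

Lemma amalg_tot_is_zmod_morphism : zmod_morphism amalg_tot.
Proof.
move=> x y; rewrite /amalg_tot -[amalg_val (x - y)]/(val (x - y)).
by rewrite rmorphB /= !rmorphB.
Qed.

Lemma amalg_tot_is_monoid_morphism : monoid_morphism amalg_tot.
Proof.
split=> [|x y]; rewrite /amalg_tot.
  by rewrite -[amalg_val 1]/(val 1) rmorph1.
by rewrite -[amalg_val (x * y)]/(val (x * y)) rmorphM /= !rmorphM.
Qed.

HB.instance Definition _ := GRing.isZmodMorphism.Build (amalg f J)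
  (tot A * tot B)%type amalg_tot amalg_tot_is_zmod_morphism.
HB.instance Definition _ := GRing.isMonoidMorphism.Build (amalg f J)
  (tot A * tot B)%type amalg_tot amalg_tot_is_monoid_morphism.

Definition im_plus_tot (y : im_plus f J) : tot B := to_tot (val y).
HB.instance Definition _ := GRing.RMorphism.copy im_plus_tot (@to_tot B \o val).

Hypothesis Jreg : regular_ideal J.

(** If d kills b in B, it kills b * j, which lies in J and hence in f(A) + J; thus b * j = 0, and b
    = 0 as j is regular. *)
Lemma im_plus_lreg (d : im_plus f J) :
  GRing.lreg d -> GRing.lreg (im_plus_val d).
Proof.
have [j Jj jreg] := Jreg.
move=> /Defs.lregP dreg; apply/Defs.lregP => b db0; apply/jreg; rewrite mulr0 mulrC.
have [|y yE] := @im_plus_elt 0 (b * j).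
  by rewrite rmorph0 subr0; exact: idealM.
rewrite -yE (dreg y) //; apply: val_inj.
by rewrite rmorphM rmorph0 /= yE mulrA db0 mul0r.
Qed.

Lemma tot_im_plus : exists psi : {rmorphism tot (im_plus f J) -> tot B},
  tot_im_plus_iso psi.
Proof.
apply: (@tot_iso _ _ im_plus_tot).
- by move=> x y /to_tot_inj/val_inj.
- by move=> d /im_plus_lreg; exact: to_tot_unit.
move=> v; have [j Jj jreg] := Jreg; have [m [e [ereg ve]]] := tot_fracP v.
(* The fraction m / e is expanded to (m j) / (e j), whose two terms lie in J and so in f(A) + J. *)
have [|d dE] := @im_plus_elt 0 (e * j).
  by rewrite rmorph0 subr0; exact: idealM.
have [|n nE] := @im_plus_elt 0 (m * j).
  by rewrite rmorph0 subr0; exact: idealM.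
exists n, d; split; last by rewrite /= /im_plus_tot /= nE dE !rmorphM /= mulrA ve.
apply/Defs.lregP => y /(congr1 val) dy0; apply: val_inj.
apply: (GRing.lregM ereg jreg).
by move: dy0; rewrite rmorphM rmorph0 mulr0 /= dE.
Qed.

Hypothesis preimJreg : regular_ideal (preim_ideal f J).

(** The two coordinates are tested separately, against (b i, 0) and (0, b j). The first is in the
    amalgamation because f (b i) lies in J, the second because b j does. *)
Lemma amalg_lreg (d : amalg f J) :
  GRing.lreg d -> GRing.lreg (amalg_val d).1 /\ GRing.lreg (amalg_val d).2.
Proof.
have [j Jj jreg] := Jreg; have [i Ji ireg] := preimJreg.
move=> /Defs.lregP dreg; split; apply/Defs.lregP => b db0.
  apply/ireg; rewrite mulr0 mulrC.
  have [|y yE] := @amalg_elt (b * i) 0.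
    by rewrite sub0r -rmorphN -mulNr rmorphM; exact: idealM.
  rewrite -[b * i]/((b * i, 0 : B).1) -yE (dreg y) //; apply: val_inj.
  rewrite rmorphM rmorph0 /= yE.
  by apply: injective_projections; rewrite /= ?mulrA ?db0 ?mul0r ?mulr0.
apply/jreg; rewrite mulr0 mulrC.
have [|y yE] := @amalg_elt 0 (b * j).
  by rewrite rmorph0 subr0; exact: idealM.
rewrite -[b * j]/((0 : A, b * j).2) -yE (dreg y) //; apply: val_inj.
rewrite rmorphM rmorph0 /= yE.
by apply: injective_projections; rewrite /= ?mulrA ?db0 ?mul0r ?mulr0.
Qed.

Lemma tot_amalg : exists phi : {rmorphism tot (amalg f J) -> tot A * tot B},
  tot_amalg_iso phi.
Proof.
apply: (@tot_iso _ _ amalg_tot).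
- move=> x y /pair_equal_spec[/to_tot_inj x1 /to_tot_inj x2]; apply: val_inj.
  exact: injective_projections.
- move=> d /amalg_lreg[/to_tot_unit[v vd] /to_tot_unit[w wd]].
  by exists (v, w); apply: injective_projections.
move=> [u v]; have [j Jj jreg] := Jreg; have [i Ji ireg] := preimJreg.
have [n [d [dreg ud]]] := tot_fracP u; have [m [e [ereg ve]]] := tot_fracP v.
(* Every pair (a i, b j) lies in the amalgamation, so n / d and m / e, expanded by i and j
   respectively, become one fraction of elements of the amalgamation. *)
have JB (a : A) (b : B) : ideal_set J (b * j - f (a * i)).
  apply: idealD; first exact: idealM.
  by rewrite -rmorphN -mulNr rmorphM; exact: idealM.
have [x xE] := amalg_elt (JB d e); have [y yE] := amalg_elt (JB n m).
exists y, x; split; last first.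
  rewrite /= /amalg_tot yE xE /= !rmorphM /= -ud -ve.
  by apply: injective_projections; rewrite /= !mulrA.
apply/Defs.lregP => z /(congr1 val); rewrite rmorphM rmorph0 /= xE.
move=> /pair_equal_spec[/= z1 z2].
apply: val_inj; apply: injective_projections.
  by apply: (GRing.lregM dreg ireg); rewrite mulr0.
by apply: (GRing.lregM ereg jreg); rewrite mulr0.
Qed.

End Amalgamation.

(** * The integral closure of the amalgamation *)

Theorem proposition3p4 (A B : comPzRingType) (f : {rmorphism A -> B})
    (J : ideal B) :
  regular_ideal J -> regular_ideal (preim_ideal f J) ->
  exists (phi : {rmorphism tot (amalg f J) -> tot A * tot B})
         (psi : {rmorphism tot (im_plus f J) -> tot B}),
    [/\ tot_amalg_iso phi,
        tot_im_plus_iso psi,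
        phi @` int_closure (amalg f J) =
          int_closure A `*` (psi @` int_closure (im_plus f J))
      & integral_morphism f ->
        phi @` int_closure (amalg f J) = int_closure A `*` int_closure B].
Proof.
move=> Jreg preimJreg.
have [phi phi_iso] := @tot_amalg A B f J Jreg preimJreg.
have [psi psi_iso] := @tot_im_plus A B f J Jreg.
(* Both images become sets of integral elements of [tot A * tot B] and [tot B], where they can be
   compared coordinate by coordinate. *)
have phiE : phi @` int_closure (amalg f J) = integral_over (@amalg_tot A B f J).
  by case: phi_iso => bij_phi phiE; exact: tot_iso_int_closure.
have psiE : psi @` int_closure (im_plus f J) =
    integral_over (@im_plus_tot A B f J).
  by case: psi_iso => bij_psi psiE; exact: tot_iso_int_closure.
have closureE : phi @` int_closure (amalg f J) =
    int_closure A `*` (psi @` int_closure (im_plus f J)).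
  rewrite phiE psiE; apply/seteqP; split=> [[u v] /integral_over_pair[uint vint]|].
    split.
      by apply: integral_over_range uint => x; exists (amalg_val x).1.
    apply: integral_over_range vint => x; have [y yE] := amalg_im_plus x.
    by exists y; rewrite /im_plus_tot /= yE.
  move=> [u v] [/= uint vint]; apply/integral_over_pair; split.
    apply: integral_over_range uint => a.
    have [|x xE] := @amalg_elt _ _ f J a (f a).
      by rewrite subrr; exact: ideal0.
    by exists x; rewrite /= xE.
  apply: integral_over_range vint => y; have [x xE] := im_plus_amalg y.
  by exists x; rewrite /= xE.
exists phi, psi; split=> // fint; rewrite closureE psiE; congr (_ `*` _).
apply/seteqP; split=> v.
  by apply: integral_over_range => y; exists (val y).
(* Since B is integral over f(A), it is integral over the larger ring f(A) + J; transitivity along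
   f(A) + J, B, [tot B] then applies. *)
apply: (@integral_over_trans _ _ _ val (@to_tot B)) => b.
apply: integral_over_range (fint b) => a.
by apply: (@im_plus_elt _ _ f J a); rewrite subrr; exact: ideal0.
Qed.
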